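(* Let $I$ be a two-sided ideal in a unital ring $R$. Then $R$ is a $QB$-ring if and only if the following three conditions are satisfied: (i) $R/I$ is a $QB$-ring; (ii) $(R_q^{-1}+I)/I=(R/I)_q^{-1}$; (iii) $I+R_q^{-1}\subset\operatorname{cl}(R_q^{-1})$.
   Context: Rings are associative. For elements $s,t$ of a unital ring $R$ write $s\perp t$ if $sRt=0$ and $tRs=0$. An element $u\in R$ is quasi-invertible, $u\in R_q^{-1}$, if there exist $c,d\in R$ with $(1-uc)\perp(1-du)$. $\operatorname{cl}(R_q^{-1})$ is the set of $a\in R$ such that whenever $xa+b=1$ for some $x,b\in R$, there is $y\in R$ with $a+yb\in R_q^{-1}$. A unital ring $R$ is a $QB$-ring if $\operatorname{cl}(R_q^{-1})=R$. $(R_q^{-1}+I)/I$ denotes the image of $R_q^{-1}$ in $R/I$. *)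

(* Defs.v *)
From HB Require Import structures.
From mathcomp Require Import all_boot all_order all_algebra.
From mathcomp Require Import generic_quotient ring_quotient.
From mathcomp Require Import boolp classical_sets.

Set Implicit Arguments.
Unset Strict Implicit.
Unset Printing Implicit Defensive.

Import GRing.Theory.
Local Open Scope ring_scope.
Local Open Scope quotient_scope.
Local Open Scope classical_set_scope.

(* Unital rings are [pzRingType]s, so that the zero ring (hence R / R) is
   allowed. *)

Record twosided_ideal (R : pzRingType) := TwosidedIdeal {
  ideal_set :> set R;
  ideal_0 : ideal_set 0;
  ideal_B : forall x y, ideal_set x -> ideal_set y -> ideal_set (x - y);
  ideal_Ml : forall r x, ideal_set x -> ideal_set (r * x);
  ideal_Mr : forall r x, ideal_set x -> ideal_set (x * r) }.

(* [ring_quotient] provides, for noncommutative rings, only the quotient of the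
   additive group (by a boolean predicate, obtained here from the Prop-valued
   ideal by classical logic); the ring structure is added below. *)
Section QuotientRing.
Variables (R : pzRingType) (I : twosided_ideal R).

Definition ideal_pred : {pred R} := fun x => `[< ideal_set I x >].

Lemma ideal_pred_zmod_closed : zmod_closed ideal_pred.
Proof.
split=> [|x y /asboolP Ix /asboolP Iy]; apply/asboolP; first exact: ideal_0.
exact: ideal_B.
Qed.

HB.instance Definition _ :=
  GRing.isZmodClosed.Build R ideal_pred ideal_pred_zmod_closed.

Definition quot_ring : Type := @Quotient.quot R ideal_pred.

HB.instance Definition _ := GRing.Zmodule.on quot_ring.

Definition quot_proj (x : R) : quot_ring := \pi_(@Quotient.quot R ideal_pred) x.

Definition quot_repr (x : quot_ring) : R := repr (x : @Quotient.quot R ideal_pred).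

Lemma quot_reprK : cancel quot_repr quot_proj.
Proof. exact: reprK. Qed.

Lemma quot_proj_eq x y : quot_proj x = quot_proj y <-> ideal_set I (x - y).
Proof.
split=> [/eqP|Ixy].
  by rewrite /quot_proj -Quotient.idealrBE => /asboolP.
by apply/eqP; rewrite /quot_proj -Quotient.idealrBE; apply/asboolP.
Qed.

Lemma quot_projB : {morph quot_proj : x y / x - y}.
Proof. by move=> x y; rewrite /quot_proj raddfB. Qed.

HB.instance Definition _ :=
  GRing.isZmodMorphism.Build R quot_ring quot_proj quot_projB.

Definition quot_one : quot_ring := quot_proj 1.
Definition quot_mul (x y : quot_ring) : quot_ring :=
  quot_proj (quot_repr x * quot_repr y).

Lemma quot_projM x y : quot_mul (quot_proj x) (quot_proj y) = quot_proj (x * y).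
Proof.
apply/quot_proj_eq; set x' := quot_repr _; set y' := quot_repr _.
have Ix : ideal_set I (x' - x) by apply/quot_proj_eq; rewrite quot_reprK.
have Iy : ideal_set I (y - y') by apply/quot_proj_eq; rewrite quot_reprK.
have -> : x' * y' - x * y = (x' - x) * y' - x * (y - y').
  by rewrite mulrBl mulrBr opprB addrA addrNK.
by apply: ideal_B; [exact: ideal_Mr | exact: ideal_Ml].
Qed.

Lemma quot_mulA : associative quot_mul.
Proof.
move=> x y z; rewrite -[x]quot_reprK -[y]quot_reprK -[z]quot_reprK.
by rewrite !quot_projM mulrA.
Qed.

Lemma quot_mul1l : left_id quot_one quot_mul.
Proof. by move=> x; rewrite -[x]quot_reprK quot_projM mul1r. Qed.

Lemma quot_mul1r : right_id quot_one quot_mul.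
Proof. by move=> x; rewrite -[x]quot_reprK quot_projM mulr1. Qed.

Lemma quot_mulDl : left_distributive quot_mul +%R.
Proof.
move=> x y z; rewrite -[x]quot_reprK -[y]quot_reprK -[z]quot_reprK.
by rewrite -raddfD !quot_projM mulrDl raddfD.
Qed.

Lemma quot_mulDr : right_distributive quot_mul +%R.
Proof.
move=> x y z; rewrite -[x]quot_reprK -[y]quot_reprK -[z]quot_reprK.
by rewrite -raddfD !quot_projM mulrDr raddfD.
Qed.

HB.instance Definition _ := GRing.Zmodule_isPzRing.Build quot_ring
  quot_mulA quot_mul1l quot_mul1r quot_mulDl quot_mulDr.

Lemma quot_proj_monoid_morphism : monoid_morphism quot_proj.
Proof. by split=> // x y; rewrite -quot_projM. Qed.

HB.instance Definition _ := GRing.isMonoidMorphism.Build R quot_ring quot_proj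
  quot_proj_monoid_morphism.

End QuotientRing.

Section QBRings.
Variable R : pzRingType.

Definition perp (s t : R) : Prop :=
  (forall r, s * r * t = 0) /\ (forall r, t * r * s = 0).

Definition quasi_inv : set R :=
  [set u | exists c d : R, perp (1 - u * c) (1 - d * u)].

Definition cl (A : set R) : set R :=
  [set a | forall x b : R, x * a + b = 1 -> exists y : R, A (a + y * b)].

Definition QB_ring : Prop := cl quasi_inv = setT.

End QBRings.
Arguments quasi_inv R : clear implicits.
Arguments QB_ring R : clear implicits.

(* Main.v *)
Require Import Defs.
From mathcomp Require Import all_boot all_order all_algebra.
From mathcomp Require Import boolp classical_sets.

(** If [xa + b = 1], conditions (i) and (ii) move [a] into [I + R_q^-1] by some
    [a + yb], and (iii) applies to the relation [x(a + yb) + (1 - xy)b = 1].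
    The only delicate point of the converse is lifting a quasi-invertible [u] of
    [R/I], with quasi-inverse [v]. The QB property of [R] yields a
    quasi-invertible lift of [u + y(1 - vu)] only; but [u + y(1 - vu)] equals
    [u(1 + z)] with [z = vy(1 - vu)] and [z^2 = 0]. Von Neumann regularity of
    the lift provides an idempotent [e] of [R] above [vu + z], and since
    [z = (vu + z)z(1 - vu - z)], [z] lifts to an element of [eR(1 - e)], again
    of square zero, so the unit [1 - z] lifts to a unit. *)

Import GRing.Theory.
Local Open Scope ring_scope.
Local Open Scope classical_set_scope.

(** The single element [v = d + c(1 - ud)] absorbs both witnesses: [1 - uv = (1 - uc)(1 - ud)] and
    [1 - vu = (1 - cu)(1 - du)], so orthogonality is inherited from the outer factors. *)
Lemma quasi_inverse {R : pzRingType} {u : R} : quasi_inv R u ->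
  exists v, [/\ u * v * u = u, v * u * v = v & perp (1 - u * v) (1 - v * u)].
Proof.
move=> [c [d [cd dc]]]; pose v := d + c * (1 - u * d).
have uvE : 1 - u * v = (1 - u * c) * (1 - u * d).
  by rewrite mulrDr opprD addrA mulrA mulrBl mul1r.
have vuE : 1 - v * u = (1 - c * u) * (1 - d * u).
  have -> : v = c + (1 - c * u) * d.
    by rewrite /v mulrBr mulrBl mulr1 mul1r mulrA addrCA.
  by rewrite mulrDl opprD addrA mulrBr mulr1 !mulrA.
have uvu : u * v * u = u.
  have uduC : (1 - u * d) * u = u * (1 - d * u).
    by rewrite mulrBl mulrBr mul1r mulr1 mulrA.
  apply/esym/eqP; rewrite -subr_eq0 -{1}[u]mul1r -mulrBl uvE -mulrA uduC.
  by rewrite mulrA cd.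
have uvuv : u * (v * u * v) = u * v by rewrite !mulrA uvu.
have vuvu : v * u * v * u = v * u by rewrite -!mulrA (mulrA u) uvu.
(* Replacing [v] by [vuv] gives the second identity and changes neither [uv] nor [vu]. *)
exists (v * u * v); split; first by rewrite uvuv.
  by rewrite vuvu !mulrA vuvu.
rewrite uvuv vuvu uvE vuE; split=> r.
  by rewrite mulrA -(mulrA _ _ r) -(mulrA _ _ (1 - c * u)) cd.
by rewrite mulrA -(mulrA _ _ r) -(mulrA _ _ (1 - u * c)) dc mulr0 mul0r.
Qed.

(** With witnesses [hc] and [hd], the defect [1 - uc] is unchanged and [1 - du] is conjugated by the
    unit [g]. *)
Lemma quasi_invMr {R : pzRingType} {u g h : R} :
  g * h = 1 -> h * g = 1 -> quasi_inv R u -> quasi_inv R (u * g).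
Proof.
move=> gh hg [c [d [cd dc]]]; exists (h * c), (h * d).
have -> : u * g * (h * c) = u * c by rewrite mulrA -(mulrA u) gh mulr1.
have -> : 1 - h * d * (u * g) = h * (1 - d * u) * g.
  by rewrite mulrBr mulr1 mulrBl hg !mulrA.
split=> r; first by rewrite !mulrA -(mulrA _ r) cd mul0r.
by rewrite -!mulrA (mulrA g) (mulrA (1 - d * u)) dc mulr0.
Qed.

Lemma quasi_inv_rmorph {R S : pzRingType} {f : {rmorphism R -> S}} {u : R} :
  (forall t, exists r, f r = t) -> quasi_inv R u -> quasi_inv S (f u).
Proof.
move=> f_surj [c [d [cd dc]]]; exists (f c), (f d).
by split=> t; have [r <-] := f_surj t;
  rewrite -(rmorph1 f) -!rmorphM -!rmorphB -!rmorphM ?cd ?dc rmorph0.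
Qed.

Lemma quasi_inv_lift {R S : pzRingType} {f : {rmorphism R -> S}} {t : S} :
  (forall s, exists r, f r = s) -> QB_ring R -> quasi_inv S t ->
  exists2 u, quasi_inv R u & f u = t.
Proof.
move=> f_surj QB /quasi_inverse[t' [tt't t'tt' [pq _]]].
have [u fu] := f_surj t; have [v fv] := f_surj t'.
have : cl (quasi_inv R) u by rewrite QB.
move=> /(_ v (1 - v * u)); rewrite addrC subrK => /(_ erefl)[y uy_qi].
have [w w_qi fw] : exists2 w, quasi_inv R w & f w = t + f y * (1 - t' * t).
  exists (u + y * (1 - v * u)) => //.
  by rewrite rmorphD rmorphM rmorphB rmorph1 rmorphM fu fv.
have [w' [ww'w _ _]] := quasi_inverse w_qi.
(* The image of the idempotent [w'w] is not under control. The correction term keeps [we = w] and,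
   since [f w] is fixed by right multiplication by [t' * f w], makes [f e = t' * f w]. *)
pose e := (w' + (1 - w' * w) * v) * w.
have we : w * e = w.
  rewrite /e mulrA mulrDr mulrDl ww'w mulrA mulrBr mulr1 mulrA ww'w.
  by rewrite subrr !mul0r addr0.
have ee : e * e = e by rewrite {1}/e -mulrA we.
pose z := t' * f y * (1 - t' * t).
have zt' : z * t' = 0 by rewrite /z -mulrA mulrBl mul1r t'tt' subrr mulr0.
have zz : z * z = 0 by rewrite {2}/z !mulrA zt' !mul0r.
(* The two sides differ by [(1 - tt') * f y * (1 - t't)], which orthogonality kills. *)
have tz : t * z = f y * (1 - t' * t).
  by apply/eqP; rewrite eq_sym -subr_eq0 -(pq (f y)) /z !mulrBl mul1r !mulrA.
have t'tz : t' * t * z = z by rewrite -mulrA tz mulrA.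
rewrite -tz in fw; have zE : t' * f y * (1 - t' * t) = z by [].
clearbody z.
have t'w : t' * f w = t' * t + z by rewrite fw mulrDr !mulrA t'tz.
have wt'w : f w * (t' * f w) = f w.
  rewrite t'w fw mulrDr mulrDl mulrA tt't -mulrA (mulrA z) zt' mul0r mulr0 addr0.
  by rewrite mulrDl -mulrA zz mulr0 addr0.
have fe : f e = t' * t + z.
  rewrite /e rmorphM rmorphD rmorphM rmorphB rmorph1 rmorphM fv mulrDl mulrBl.
  by rewrite mul1r mulrBl -!mulrA wt'w t'w addrC subrK.
clearbody e; pose Z := e * (v * y * (1 - v * u)) * (1 - e).
have fZ : f Z = z.
  rewrite /Z !rmorphM !rmorphB !rmorph1 rmorphM fe fu fv zE.
  by rewrite mulrDl t'tz zz addr0 mulrBr mulr1 mulrDr zz mulrA zt' mul0r addr0 subr0.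
have ZZ : Z * Z = 0.
  have e'e : (1 - e) * e = 0 by rewrite mulrBl mul1r ee subrr.
  by rewrite /Z !mulrA -(mulrA _ (1 - e) e) e'e mulr0 !mul0r.
clearbody Z.
(* Its image is [(t + tz)(1 - z) = t], as [z] squares to zero. *)
exists (w * (1 - Z)).
  by apply: (quasi_invMr (h := 1 + Z)) => //;
    rewrite ?(mulrBl, mulrBr, mulrDl, mulrDr) !(mul1r, mulr1) ZZ ?addr0 ?subr0;
    rewrite ?addrK ?subrK.
by rewrite rmorphM rmorphB rmorph1 fZ fw mulrBr mulr1 mulrDl -mulrA zz mulr0 addr0 addrK.
Qed.

Theorem theorem7p2 (R : pzRingType) (I : twosided_ideal R) :
  QB_ring R <->
  [/\ QB_ring (quot_ring I),
      quot_proj I @` quasi_inv R = quasi_inv (quot_ring I)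
    & [set i + u | i in I & u in quasi_inv R] `<=` cl (quasi_inv R)].
Proof.
have f_surj (t : quot_ring I) : exists r, quot_proj I r = t.
  by exists (quot_repr t); exact: quot_reprK.
split=> [QB | [QBq lift Icl]].
  split; last by rewrite QB.
  - apply/seteqP; split=> // a _ x b.
    rewrite -[a]quot_reprK -[x]quot_reprK.
    set a' := quot_repr a; set x' := quot_repr x => xab.
    have : cl (quasi_inv R) a' by rewrite QB.
    (* Taking [1 - x'a'] as the lift of [b] makes the relation hold exactly in [R], not just modulo
       [I]. *)
    move=> /(_ x' (1 - x' * a')); rewrite addrC subrK => /(_ erefl)[y qy].
    exists (quot_proj I y).
    have -> : b = quot_proj I (1 - x' * a').
      by rewrite rmorphB rmorph1 rmorphM -xab addrC addKr.
    by rewrite -rmorphM -rmorphD; exact: quasi_inv_rmorph.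
  - apply/seteqP; split=> [_ [u qu <-]|t qt]; first exact: quasi_inv_rmorph.
    by have [u qu ut] := quasi_inv_lift f_surj QB qt; exists u.
apply/seteqP; split=> // a _ x b xab.
have : cl (quasi_inv (quot_ring I)) (quot_proj I a) by rewrite QBq.
move=> /(_ (quot_proj I x) (quot_proj I b)).
rewrite -rmorphM -rmorphD xab rmorph1 => /(_ erefl)[t].
have [y <-] := f_surj t; rewrite -rmorphM -rmorphD -lift => -[u qu uE].
have : cl (quasi_inv R) (a + y * b).
  apply: Icl; exists (a + y * b - u); last by exists u => //; rewrite subrK.
  exact/quot_proj_eq.
move=> /(_ x (b - x * y * b)); rewrite mulrDr mulrA addrACA subrr addr0.
move=> /(_ xab)[y' qy']; exists (y + y' * (1 - x * y)).
by rewrite mulrDl addrA -mulrA mulrBl mul1r.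
Qed.
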